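(* Let $d,r,k \in \mathbb{Z}^+$. For $1 \leq j \leq d$, let $A_j$ be an $\ell_j \times k$ matrix with integer entries, of rank $\ell_j$, satisfying the columns condition. There exists a constant $c = c(A_1,\dots,A_d,d,r)>0$ such that for every $n$, every $r$-coloring of $[1,n]^d$ admits at least $cn^{\sum_{i=1}^d(k-\ell_i)}(1+o(1))$ (as $n\to\infty$) monochromatic $k$-tuples of points $\mathbf{p}_1,\dots,\mathbf{p}_k\in[1,n]^d$ such that, letting $B=[\mathbf{p}_1\,\mathbf{p}_2\,\cdots\,\mathbf{p}_k]$ be the $d\times k$ matrix with these columns and $\mathbf{r}_j$ its $j$-th row, we have $A_j\mathbf{r}_j^\intercal=\mathbf{0}$ for every $j\in[1,d]$.
   Context: $[1,n]=\{1,2,\dots,n\}$. Columns condition: an $\ell \times k$ matrix $A$ with columns $\mathbf{c}_1,\dots,\mathbf{c}_k$ satisfies the columns condition if, after renumbering the columns if necessary, there exist indices $0=i_0<i_1<\cdots<i_m=k$ such that, with $\mathbf{s}_j=\sum_{i=i_{j-1}+1}^{i_j}\mathbf{c}_i$ for $1\le j\le m$, we have $\mathbf{s}_1=\mathbf{0}$, and for each $2\le j\le m$, $\mathbf{s}_j$ is a linear combination over $\mathbb{Q}$ of $\mathbf{c}_1,\dots,\mathbf{c}_{i_{j-1}}$. *)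

(* Defs.v *)
From mathcomp Require Export all_boot all_order all_fingroup all_algebra.
From mathcomp Require Export all_classical all_reals all_analysis.
Export Order.TTheory GRing.Theory Num.Theory.
Export numFieldNormedType.Exports.

Set Implicit Arguments.
Unset Strict Implicit.
Unset Printing Implicit Defensive.

Local Open Scope ring_scope.

Definition ratmx (l k : nat) (A : 'M[int]_(l, k)) : 'M[rat]_(l, k) :=
  map_mx intr A.

(* [s] renumbers the columns and [i 0 < ... < i m] are the block boundaries
   (values of [i] beyond [m] are irrelevant). Columns are indexed from 0, so
   the block c_{i_{j-1}+1}, ..., c_{i_j} consists of the columns [q] with
   [i (j-1) <= q < i j], and c_1, ..., c_{i_{j-1}} of those with
   [q < i (j-1)]. *)
Definition columns_condition (l k : nat) (A : 'M[rat]_(l, k)) : Prop :=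
  exists (s : 'S_k) (m : nat) (i : nat -> nat),
    let c (q : 'I_k) : 'cV[rat]_l := col q (col_perm s A) in
    let S (j : nat) : 'cV[rat]_l := \sum_(q < k | (i j.-1 <= q < i j)%N) c q in
    [/\ (0 < m)%N,
        i 0%N = 0%N /\ i m = k,
        forall j : nat, (j < m)%N -> (i j < i j.+1)%N,
        S 1%N = 0
      & forall j : nat, (2 <= j <= m)%N ->
          exists a : 'I_k -> rat, S j = \sum_(q < k | (q < i j.-1)%N) a q *: c q].

(* The grid [1,n]^d; the coordinate [x : 'I_n] stands for the integer x + 1. *)
Definition grid (n d : nat) := {ffun 'I_d -> 'I_n}.

Definition point_mx (n d k : nat) (p : k.-tuple (grid n d)) : 'M[int]_(d, k) :=
  \matrix_(j < d, i < k) ((tnth p i j).+1)%:Z.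

Definition monochromatic (n d k r : nat) (chi : grid n d -> 'I_r)
    (p : k.-tuple (grid n d)) : bool :=
  [exists a : 'I_r, forall i : 'I_k, chi (tnth p i) == a].

Definition mono_solutions (n d k r : nat) (l : 'I_d -> nat)
    (A : forall j : 'I_d, 'M[int]_(l j, k)) (chi : grid n d -> 'I_r) :
    {set k.-tuple (grid n d)} :=
  [set p : k.-tuple (grid n d) | monochromatic chi p &
     [forall j : 'I_d, A j *m (row j (point_mx p))^T == 0]].

(* Main.v *)
Require Import Defs.
From mathcomp Require Import zify ring.

(** Van der Waerden's theorem gives monochromatic Deuber (m,p,c)-sets, and the
columns condition writes solutions of [A x = 0] as elements of such a set. A
last, smallest generator [e] yields, for a prescribed kernel vector [w], two
solutions [x] and [x + e w] with [e <> 0] whose entries all have one colour.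

Replace coordinate [j] of the grid by [k - l j] formal coordinates, one for each
vector of a basis of the kernel of [A j], and take the product of these
configurations. In every formal coordinate one may choose [x] or [x + e w], and
since the determinant is multilinear some choice makes the [k - l j] rows
linearly independent. This gives a finite box such that every [r]-colouring of
it has a monochromatic solution with independent rows.

Every vector [t] of integers in [[1,s]], with [s] a constant multiple of [n],
maps the box into [[1,n]^d] by sending a formal point to its combinations with
coefficients [t], and hence produces a monochromatic solution. By independence
[t] is recovered from this solution and the pattern in the box, so there are at
least [s ^ (\sum_j (k - l j))] solutions up to the number of patterns. *)

Set Implicit Arguments.
Unset Strict Implicit.
Unset Printing Implicit Defensive.

Local Open Scope nat_scope.

(** * Van der Waerden's theorem *)

(** Induction on [s]. The hypothesis, applied to blocks of consecutive integers coloured by their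
    whole pattern, yields [k] equally coloured blocks in arithmetic progression. The focus inside
    such a block either has a colour of [cs], which completes a progression at [t = 0], or
    contributes a new colour. *)
Lemma color_focusing (k : nat) :
  (forall K : finType, exists N, forall chi : nat -> K,
     exists a e c, [/\ a <= N, 0 < e <= N &
       forall t, 0 < t <= k -> chi (a + t * e) = c]) ->
  forall (K : finType) (s : nat), exists N, forall chi : nat -> K,
    (exists a e c, [/\ a <= N, 0 < e <= N &
       forall t, t <= k -> chi (a + t * e) = c]) \/
    (exists f (cs : seq K), [/\ f <= N, uniq cs, size cs = s &
       forall c, c \in cs -> exists2 e, 0 < e <= N &
         forall t, 0 < t <= k -> chi (f + t * e) = c]).
Proof.
move=> vdW K; elim=> [|s [N HN]].
  by exists 0 => chi; right; exists 0, [::].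
(* A block of length [B] has room for every [f + t * e] with [f, e <= N] and [t <= k]. *)
pose B := (N + k * N).+1.
have [W HW] := vdW {ffun 'I_B -> K}.
exists (W + W + N) => chi.
have [b [E [c0 [bW /andP[E0 EW] HbE]]]] :=
  HW (fun x => [ffun u : 'I_B => chi (x + u)]).
pose chi1 u := chi (b + E + u).
have shift t u : 0 < t <= k -> u < B -> chi (b + t * E + u) = chi1 u.
  move=> /[dup] ht /andP[t0 tk] uB.
  have h1 : 0 < 1 <= k by rewrite /= (leq_trans t0 tk).
  have := etrans (HbE _ ht) (esym (HbE _ h1)).
  by move/ffunP/(_ (Ordinal uB)); rewrite !ffunE /= mul1n.
have inB f e t : f <= N -> e <= N -> t <= k -> f + t * e < B.
  by move=> fN eN tk; rewrite ltnS leq_add // leq_mul.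
case: (HN chi1) => [[a [e [c [aN /andP[e0 eN] Hc]]]]|].
  left; exists (b + E + a), e, c; split; last first.
  - by move=> t tk; rewrite -(Hc t tk) /chi1 addnA.
  - by rewrite e0 (leq_trans eN) // leq_addl.
  - by rewrite leq_add // leq_add.
move=> [f [cs [fN ucs scs Hcs]]].
case: (boolP (chi1 f \in cs)) => [fcs|fcs].
  have [e /andP[e0 eN] He] := Hcs _ fcs.
  left; exists (b + E + f), e, (chi1 f); split.
  - by rewrite leq_add // leq_add.
  - by rewrite e0 (leq_trans eN) // leq_addl.
  - case=> [_|t tk]; first by rewrite mul0n addn0.
    by rewrite -addnA; apply: (He t.+1).
(* The new focus lies in the block at [b], just before the equal ones. The step is [E] for the new
   colour and [E + e] for an old one, so the [t]-th term falls into the [t]-th equal block. *)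
right; exists (b + f), (chi1 f :: cs); split => /=.
- by rewrite leq_add // (leq_trans bW) // leq_addl.
- by rewrite fcs ucs.
- by rewrite scs.
move=> c; rewrite inE => /orP[/eqP ->|ccs].
  exists E; first by rewrite E0 (leq_trans EW) // -addnA leq_addr.
  move=> t ht; rewrite addnAC shift //.
  by rewrite -[f]addn0 -(muln0 0) inB.
have [e /andP[e0 eN] He] := Hcs _ ccs.
exists (E + e).
  by rewrite addn_gt0 E0 /= leq_add // (leq_trans EW) // leq_addl.
move=> t /[dup] ht /andP[_ tk].
rewrite mulnDr addnACA shift //; first exact: He.
exact: inB.
Qed.

(** Induction on [k]: [#|K|.+1] distinct focused colours cannot exist, so focusing must end with a
    longer progression. *)
Lemma van_der_Waerden (k : nat) (K : finType) :
  exists N, forall chi : nat -> K,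
    exists a e c, [/\ a <= N, 0 < e <= N &
      forall t, 0 < t <= k -> chi (a + t * e) = c].
Proof.
elim: k K => [|k IH] K.
  exists 1 => chi; exists 0, 1, (chi 0); split => // -[|t] //.
have [N HN] := @color_focusing k IH K #|K|.+1.
exists (N + N) => chi.
(* Terms are numbered from 1 here and from 0 in [color_focusing], so the start moves back by [e];
   the shift by [N] keeps it a natural number. *)
case: (HN (fun x => chi (N + x))) => [[a [e [c [aN /andP[e0 eN] Hc]]]]|].
  exists (N + a - e), e, c; split.
  - by rewrite (leq_trans (leq_subr _ _)) // leq_add2l.
  - by rewrite e0 (leq_trans eN) // leq_addr.
  - case=> // t; rewrite ltnS => tk; rewrite -(Hc t tk); congr chi.
    rewrite mulSn addnA subnK ?addnA //.
    by rewrite (leq_trans eN) // leq_addr.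
move=> [f [cs [_ ucs scs _]]].
by have := max_card (mem cs); rewrite (card_uniqP ucs) scs ltnn.
Qed.

Local Open Scope ring_scope.

(** * Deuber sets *)

(** These are the sums of [b i * y i] over [i < j] with integers [|b i| <= p]. Coefficients are
    peeled off one at a time to suit induction on [j]. *)
Fixpoint bounded_span (p : nat) (y : nat -> int) (j : nat) (x : int) : Prop :=
  if j is i.+1 then
    exists2 b : int, `|b| <= p%:Z & bounded_span p y i (x - b * y i)
  else x = 0.

Lemma bounded_span_sum p y j (b : nat -> int) :
  (forall i, (i < j)%N -> `|b i| <= p%:Z) ->
  bounded_span p y j (\sum_(i < j) b i * y i).
Proof.
elim: j => [|j IH] hb /=; first by rewrite big_ord0.
exists (b j); first exact: hb.
by rewrite big_ord_recr /= addrK; apply: IH => i ij; apply: hb; rewrite ltnW.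
Qed.

Lemma bounded_span_widen p y i j x :
  (i <= j)%N -> bounded_span p y i x -> bounded_span p y j x.
Proof.
elim: j => [|j IH]; first by rewrite leqn0 => /eqP ->.
rewrite leq_eqVlt => /orP[/eqP -> //|ij] hx.
by exists 0; rewrite ?normr0 // mul0r subr0; apply: IH.
Qed.

(** Generators skipped by [f] receive the coefficient 0. *)
Lemma bounded_span_subseq p y (f : nat -> nat) j m x :
  (forall a, (a < j)%N -> (f a < m)%N) ->
  (forall a b, (a < b < j)%N -> (f a < f b)%N) ->
  bounded_span p (y \o f) j x -> bounded_span p y m x.
Proof.
elim: j m x => [|j IH] m x hm hf /=.
  by move=> ->; apply: (@bounded_span_widen _ _ 0%N).
move=> [b hb hx]; apply: (@bounded_span_widen _ _ (f j).+1); first exact: hm.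
exists b => //; apply: IH hx.
  by move=> a aj; apply: hf; rewrite aj leqnn.
by move=> a c /andP[ac cj]; apply: hf; rewrite ac ltnW.
Qed.

Lemma bounded_span_scale p (y y' : nat -> int) (s : int) j (x : int) :
  (forall i, (i < j)%N -> y' i = s * y i) ->
  bounded_span p y' j x -> exists2 z : int, x = s * z & bounded_span p y j z.
Proof.
elim: j x => [|j IH] x hy /=; first by move=> ->; exists 0; rewrite ?mulr0.
move=> [b hb /IH [|z hz hs]]; first by move=> i ij; apply: hy; rewrite ltnW.
exists (z + b * y j); last by exists b => //; rewrite addrK.
by move/eqP: hz; rewrite subr_eq hy // => /eqP ->; rewrite mulrDr mulrCA.
Qed.

Lemma bounded_span_norm p y N j x :
  (forall i, (i < j)%N -> `|y i| <= N%:Z) ->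
  bounded_span p y j x -> `|x| <= (j * (p * N))%:Z.
Proof.
elim: j x => [|j IH] x hy /=; first by move=> ->; rewrite normr0.
move=> [b hb /IH h]; rewrite -[x](subrK (b * y j)).
apply: (le_trans (ler_normD _ _)); rewrite mulSn addnC PoszD lerD //.
  by apply: h => i ij; apply: hy; rewrite ltnW.
by rewrite normrM PoszM ler_pM // hy.
Qed.

(* Deuber's (M,p,c)-sets, with [y] listed from the last generator to the first,
   each row being monochromatic. *)
Lemma row_monochromatic_Deuber (p c M : nat) (K : finType) : (0 < c)%N ->
  exists N : nat, forall chi : int -> K,
    exists (y : nat -> int) (col : nat -> K), forall j, (j < M)%N ->
      0 < y j <= N%:Z /\
      forall x, bounded_span p y j x ->
        0 < c%:Z * y j + x <= N%:Z /\ chi (c%:Z * y j + x) = col j.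
Proof.
move=> c0; elim: M => [|M [N HN]].
  by exists 0%N => chi; exists (fun=> 0), (fun=> chi 0).
pose L := (M * (p * N))%N.
have [W HW] := van_der_Waerden (L + L).+1 K.
exists (c * (W + (L + L).+1 * W) + c * W * N)%N => chi.
have [a [e [cl [aW /andP[e0 eW] Hcl]]]] := HW (fun x => chi (c * x)%N%:Z).
have [y [col Hy]] := HN (fun x => chi ((c * e)%N%:Z * x)).
(* The old generators are scaled by [c * e]; the new one is the middle term of a progression of
   [2L + 1] terms. A combination of the scaled generators equals [c * e * z] with [|z| <= L], so
   adding it to [c] times the middle term gives [c] times another term. *)
pose y' i : int := if (i < M)%N then (c * e)%N%:Z * y i else (a + L.+1 * e)%N%:Z.
have y'E i : (i < M)%N -> y' i = (c * e)%N%:Z * y i by rewrite /y' => ->.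
exists y', (fun i => if (i < M)%N then col i else cl) => j.
have small (z : int) : 0 < z <= N%:Z -> 0 < (c * e)%N%:Z * z <=
    (c * (W + (L + L).+1 * W) + c * W * N)%N%:Z.
  case: z => // z; rewrite ltz_nat lez_nat => /andP[z0 zN].
  rewrite -PoszM ltz_nat lez_nat !muln_gt0 c0 e0 z0 /=.
  by rewrite (leq_trans _ (leq_addl _ _)) // !leq_mul.
have bnd t : (t <= (L + L).+1)%N -> (a + t * e <= W + (L + L).+1 * W)%N.
  by move=> tL; rewrite leq_add // leq_mul.
rewrite ltnS leq_eqVlt => /orP[/eqP -> {j}|jM]; last first.
  rewrite y'E // jM; have [hj Hj] := Hy j jM; split; first exact: small.
  move=> x /(bounded_span_scale (s := (c * e)%N%:Z) (y := y)) [i ij|z ->].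
    by apply: y'E; apply: ltn_trans jM.
  by move=> /Hj [h1 h2]; rewrite mulrCA -mulrDr h2; split => //; apply: small.
rewrite {1 2}/y' ltnn; split.
  rewrite ltz_nat lez_nat addn_gt0 muln_gt0 e0 orbT /=.
  rewrite (leq_trans (bnd _ _)) ?ltnS ?leq_addr //.
  by rewrite (leq_trans _ (leq_addr _ _)) // leq_pmull.
move=> x /(bounded_span_scale y'E) [z -> hz].
have zL : `|z| <= L%:Z.
  apply: bounded_span_norm hz => i iM.
  by have [/andP[h1 h2] _] := Hy i iM; rewrite gtr0_norm.
rewrite /y' ltnn.
have [t tE] : exists t : nat, t%:Z = L.+1%:Z + z.
  by exists (absz (L.+1%:Z + z)); lia.
have tL : (0 < t <= (L + L).+1)%N by lia.
have -> : c%:Z * (a + L.+1 * e)%N%:Z + (c * e)%N%:Z * z =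
    (c * (a + t * e))%N%:Z.
  by move: (L.+1) tE => L1 tE; rewrite !PoszM !PoszD !PoszM tE; ring.
rewrite (Hcl t tL); split => //; rewrite ltz_nat lez_nat.
move/andP: tL => [t0 tL].
rewrite muln_gt0 addn_gt0 muln_gt0 c0 t0 e0 orbT /=.
by rewrite (leq_trans _ (leq_addr _ _)) // leq_mul // bnd.
Qed.

Lemma pigeonhole_iota (K : finType) (col : nat -> K) (m M : nat) :
  (m * #|K| < M)%N ->
  exists a, (m <= count (fun j => col j == a) (iota 0 M))%N.
Proof.
move=> hM; apply/existsP; move: hM; apply: contraLR => /existsPn small.
have total : (\sum_(a : K) count (fun j => col j == a) (iota 0 M) = M)%N.
  under eq_bigr do rewrite -sum1_count big_mkcond.
  rewrite exchange_big /= -[RHS](size_iota 0) -sum1_size.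
  by apply: eq_bigr => j _; rewrite -big_mkcond /= (big_pred1 (col j)).
rewrite -leqNgt -{1}total mulnC -sum_nat_const leq_sum // => a _.
by rewrite ltnW // ltnNge small.
Qed.

(** Among [m * #|K| + 1] rows some [m] share a colour, and combinations of the generators of these
    rows are combinations of the full list. *)
Lemma monochromatic_Deuber (p c m : nat) (K : finType) : (0 < c)%N ->
  exists N : nat, forall chi : int -> K,
    exists (y : nat -> int) (a : K), forall j, (j < m)%N ->
      0 < y j /\
      forall x, bounded_span p y j x ->
        0 < c%:Z * y j + x <= N%:Z /\ chi (c%:Z * y j + x) = a.
Proof.
move=> c0; pose M := (m * #|K|).+1.
have [N HN] := row_monochromatic_Deuber p M K c0.
exists N => chi; have [y [col Hy]] := HN chi.
have [a ha] := pigeonhole_iota col (ltnSn (m * #|K|)).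
pose js := [seq j <- iota 0 M | col j == a].
have jsm : (m <= size js)%N by rewrite size_filter.
have js_in b : (b < m)%N -> (nth 0 js b < M)%N /\ col (nth 0 js b) = a.
  move=> bm; have : nth 0%N js b \in js by rewrite mem_nth // (leq_trans bm).
  by rewrite mem_filter mem_iota /= add0n => /andP[/eqP ? ?].
have js_incr b b' : (b < b')%N -> (b' < m)%N -> (nth 0 js b < nth 0 js b')%N.
  move=> bb bm; apply: (sorted_ltn_nth ltn_trans) => //.
  - exact/(sorted_filter ltn_trans)/iota_ltn_sorted.
  - by rewrite inE (leq_trans (ltn_trans bb bm)).
  - by rewrite inE (leq_trans bm).
exists (y \o nth 0%N js), a => j jm /=; have [hj <-] := js_in j jm.
have [/andP[y0 _] Hj] := Hy _ hj; split => // x hx; apply: Hj.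
apply: bounded_span_subseq hx => [b bj|b b' /andP[bb bj]]; apply: js_incr => //.
exact: ltn_trans jm.
Qed.

(** * Kernel vectors from the columns condition *)

Lemma common_denominator (I : finType) (f : I -> rat) :
  exists2 c : nat, (0 < c)%N &
    exists g : I -> int, forall i, (g i)%:~R = c%:R * f i.
Proof.
pose D := \prod_i denq (f i).
have D0 : 0 < D by apply: prodr_gt0 => i _; apply: denq_gt0.
exists `|D|%N; first by rewrite absz_gt0 gt_eqF.
exists (fun i => numq (f i) * \prod_(j | j != i) denq (f j)) => i.
have -> : (`|D|%N)%:R = D%:~R :> rat by rewrite -[in RHS](gtz0_abs D0).
by rewrite /D [in RHS](bigD1 i) //= !intrM numqE; ring.
Qed.

(* The columns condition provides a triangular system of kernel vectors: the
   vector of the block containing [q] has the constant entry [c] at [q], and the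
   vectors of the earlier blocks, which get the larger indices, vanish at [q]. *)
Lemma columns_condition_kernel (l k : nat) (A : 'M[int]_(l, k)) :
  columns_condition (ratmx A) ->
  exists (m : nat) (b : 'I_k -> nat) (c : nat) (U : nat -> 'cV[int]_k),
    [/\ (0 < c)%N, forall q, (b q < m)%N,
        forall q, U (b q) q 0 = c%:Z,
        forall q i, (b q < i < m)%N -> U i q 0 = 0
      & forall i, A *m U i = 0].
Proof.
move=> [s [m [ix [m0 [ix0 ixm] ixlt S1 Sj]]]].
case: m m0 ixm ixlt Sj => // m _ ixm ixlt Sj.
pose c (q : 'I_k) : 'cV[rat]_l := col q (col_perm s (ratmx A)).
(* Blocks are counted from 0; for block 0 the combination on the right is empty, in agreement with
   [S1]. *)
have hS (t : 'I_m.+1) : exists a : 'I_k -> rat,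
    \sum_(q < k | (ix t <= q < ix t.+1)%N) c q
      = \sum_(q < k | (q < ix t)%N) a q *: c q.
  case: t => -[|t] ht /=; last exact: (Sj t.+2).
  by exists (fun=> 0); rewrite S1 big1 // => q; rewrite scale0r.
have {hS} [a Ha] := choice hS.
have ix_mono t t' : (t <= t' <= m.+1)%N -> (ix t <= ix t')%N.
  elim: t' => [|t' IH]; first by rewrite leqn0 andbT => /eqP ->.
  rewrite leq_eqVlt => /andP[/orP[/eqP -> //|tt'] tm].
  by rewrite (leq_trans (IH _)) ?(ltnW (ixlt _ tm)) // -ltnS tt' ltnW.
pose pos (q : 'I_k) := s^-1%g q.
have hblock q : exists t, (t < m.+1)%N && (ix t <= pos q < ix t.+1)%N.
  have hex : exists t, (pos q < ix t)%N by exists m.+1; rewrite ixm.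
  case: (ex_minnP hex) => -[|t]; first by rewrite ix0.
  move=> ht hmin; exists t; rewrite ht andbT hmin ?ixm //=.
  by rewrite leqNgt; apply/negP => /hmin; rewrite ltnn.
have [bl Hbl] := choice hblock.
(* [u t] encodes the relation of block [t]: 1 on the block, minus the coefficients on earlier
   columns, 0 on later ones. *)
pose u (t : 'I_m.+1) (q : 'I_k) : rat :=
  (ix t <= pos q < ix t.+1)%N%:R - (if (pos q < ix t)%N then a t (pos q) else 0).
have [d d0 [g Hg]] := common_denominator (fun z : 'I_m.+1 * 'I_k => u z.1 z.2).
exists m.+1, (fun q => m - bl q)%N, d,
  (fun i => \col_q g (inord (m - i), q)).
have blm q : (bl q <= m)%N by have /andP[] := Hbl q.
split => // [q|q|q i|i]; first by rewrite ltnS leq_subr.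
- rewrite mxE; apply: (@intr_inj rat); rewrite Hg /u /= subKn // inordK ?ltnS //.
  have /and3P[_ h1 h2] := Hbl q.
  by rewrite h1 h2 ltnNge h1 /= subr0 mulr1.
- move=> /andP[h1 h2]; rewrite mxE; apply: (@intr_inj rat); rewrite Hg /u /=.
  have hlt : (m - i < bl q)%N by have := blm q; lia.
  rewrite inordK ?ltnS ?leq_subr //.
  have /and3P[_ h3 h4] := Hbl q.
  have h5 : (ix (m - i).+1 <= pos q)%N.
    by rewrite (leq_trans _ h3) // ix_mono // hlt ltnW // ltnS.
  have h6 : (ix (m - i) <= pos q)%N.
    by rewrite (leq_trans _ h3) // ix_mono // (ltnW hlt) ltnW // ltnS.
  by rewrite [(pos q < ix (m - i).+1)%N]ltnNge h5 andbF ltnNge h6 /= subr0 mulr0.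
- apply/matrixP => x z; rewrite !mxE; apply: (@intr_inj rat).
  rewrite rmorph_sum rmorph0 /=.
  set t : 'I_m.+1 := inord (m - i).
  under eq_bigr => q _ do rewrite mxE rmorphM /= Hg mulrCA /=.
  rewrite -mulr_sumr (reindex_inj (@perm_inj _ s)) /=.
  rewrite /u /pos; under eq_bigr => q _ do rewrite permK mulrBr.
  rewrite sumrB; have := congr1 (fun M : 'cV_l => M x 0) (Ha t).
  rewrite !summxE big_mkcond [in RHS]big_mkcond /= => E.
  rewrite [X in X - _](_ : _ = \sum_(q < k) (if (ix t <= q < ix t.+1)%N
     then c q x 0 else 0)); last first.
    by apply: eq_bigr => q _; rewrite !mxE; case: ifP; rewrite ?mulr1 ?mulr0.
  rewrite E -sumrB big1 ?mulr0 // => q _.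
  by rewrite !mxE; case: ifP; rewrite ?mulr0 ?subr0 // mulrC subrr.
Qed.

(** * Partition regular configurations and their products *)

(** [N] is chosen before the colouring, which lets the product argument work in a finite box. *)
Definition partition_regular (I : Type) (C : (I -> int) -> Prop) : Prop :=
  forall K : finType, exists N : nat, forall chi : int -> K,
    exists (x : I -> int) (a : K),
      C x /\ forall i, 0 < x i <= N%:Z /\ chi (x i) = a.

(** Take [X] to be the sum of the [y i.+1 *: U i], and [e = y 0]. By triangularity, entry [q] is
    [c * y (b q).+1] plus a combination of generators of smaller index, among them [y 0], so it lies
    in the Deuber set with or without [e * w]. *)
Lemma kernel_pair_regular (l k : nat) (A : 'M[int]_(l, k)) (w : 'cV[int]_k) :
  columns_condition (ratmx A) -> A *m w = 0 ->
  partition_regular (fun x : 'I_k * bool -> int =>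
    exists (X : 'cV[int]_k) (e : int), [/\ A *m X = 0, e != 0 &
      forall q b, x (q, b) = X q 0 + (if b then e * w q 0 else 0)]).
Proof.
move=> /columns_condition_kernel [m [b [c [U [c0 bm Ub U0 AU]]]]] Aw K.
(* A crude bound for every coefficient in row [q], whatever [q] is. *)
pose p := (\sum_(i < m) \sum_q absz (U i q 0%R) + \sum_q absz (w q 0%R))%N.
have [N HN] := monochromatic_Deuber p m.+1 K c0.
exists N => chi; have [y [a Hy]] := HN chi.
pose X := \sum_(i < m) y i.+1 *: U i.
exists (fun z => X z.1 0 + (if z.2 then y 0%N * w z.1 0 else 0)), a; split.
  exists X, (y 0%N); split => //; last by have [/lt0r_neq0] := Hy 0%N isT.
  by rewrite mulmx_sumr big1 // => i _; rewrite -scalemxAr AU scaler0.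
move=> [q eps] /=; have [_ Hq] := Hy (b q).+1 (bm q).
pose v i := if i is i'.+1 then U i' q 0 else if eps then w q 0 else 0.
suff -> : X q 0 + (if eps then y 0%N * w q 0 else 0) =
    c%:Z * y (b q).+1 + \sum_(i < (b q).+1) v i * y i.
  apply/Hq/bounded_span_sum => -[_|i] /=.
    case: eps @v => _; rewrite ?normr0 // -abszE lez_nat /p (bigD1 q) //=.
    by rewrite addnCA leq_addr.
  rewrite ltnS => ib; rewrite -abszE lez_nat /p.
  rewrite (bigD1 (Ordinal (ltn_trans ib (bm q)))) //= (bigD1 q) //=.
  by rewrite -!addnA leq_addr.
have -> : X q 0 = c%:Z * y (b q).+1 + \sum_(i < b q) U i q 0 * y i.+1.
  rewrite /X summxE; under eq_bigr => i _ do rewrite mxE mulrC.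
  rewrite (bigID (fun i : 'I_m => i < (b q).+1)%N) /= [X in _ + X]big1 ?addr0.
    rewrite -(big_ord_widen _ (fun i => U i q 0 * y i.+1)) //.
    by rewrite big_ord_recr /= Ub addrC.
  by move=> i; rewrite -leqNgt => bi; rewrite U0 ?mul0r // bi ltn_ord.
rewrite big_ord_recl /= addrA [RHS]addrAC; congr (_ + _ + _).
by case: eps @v => v /=; rewrite ?mul0r // mulrC.
Qed.

Lemma partition_regular_comp (I I' : Type) (h : I' -> I) (C : (I -> int) -> Prop) :
  partition_regular C ->
  partition_regular (fun x : I' -> int => exists2 x0, C x0 & x = x0 \o h).
Proof.
move=> HC K; have [N HN] := HC K; exists N => chi.
have [x [a [Cx Hx]]] := HN chi; exists (x \o h), a.
by split=> [|i]; [exists x|apply: Hx].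
Qed.

(* Colour the values of one coordinate by the induced colourings of the box
   spanned by the others: a configuration which is monochromatic for these
   colours can be combined with any configuration in the box. *)
Lemma partition_regular_product (I : Type) (i0 : I) (J : finType)
    (C : J -> (I -> int) -> Prop) :
  (forall j, partition_regular (C j)) ->
  forall K : finType, exists N : nat, forall chi : {ffun J -> int} -> K,
    exists (x : I -> {ffun J -> int}) (a : K),
      (forall j, C j (fun i => x i j)) /\
      forall i, (forall j, 0 < x i j <= N%:Z) /\ chi (x i) = a.
Proof.
move=> HC K.
(* [C] is required only on the coordinates in [S]; the others merely stay in the range. *)
suff : forall S : seq J, exists N : nat, (0 < N)%N /\
    forall chi : {ffun J -> int} -> K,
    exists (x : I -> {ffun J -> int}) (a : K),
      (forall j, j \in S -> C j (fun i => x i j)) /\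
      forall i, (forall j, 0 < x i j <= N%:Z) /\ chi (x i) = a.
  move=> /(_ (enum J)) [N [_ HN]]; exists N => chi.
  have [x [a [Cx Hx]]] := HN chi; exists x, a; split => // j.
  by apply: Cx; rewrite mem_enum.
elim=> [|j S [N [N0 HN]]].
  exists 1%N; split => // chi; exists (fun=> [ffun=> 1]), (chi [ffun=> 1]).
  by split=> // i; split => // j; rewrite ffunE.
pose box := {ffun J -> 'I_N.+1}.
pose upd (u : {ffun J -> int}) (y : int) : {ffun J -> int} :=
  [ffun j' => if j' == j then y else u j'].
pose emb (u : box) : {ffun J -> int} := [ffun j' => (u j' : nat)%:Z].
have [N' HN'] := HC j {ffun box -> K}.
exists (N + N')%N; split; first by rewrite addn_gt0 N0.
move=> chi.
have [y [f [Cy Hy]]] := HN' (fun z => [ffun u => chi (upd (emb u) z)]).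
(* All values [y i] induce the same colouring of the box, so [y i0] may represent them. *)
have [x [a [Cx Hx]]] := HN (fun u => chi (upd u (y i0))).
exists (fun i => upd (x i) (y i)), a; split.
  move=> j'; rewrite inE; have [->|jj] /= := eqVneq j' j.
    by move=> _; congr (C j _): Cy; apply/funext => i; rewrite ffunE eqxx.
  by move=> /Cx; congr (C j' _); apply/funext => i; rewrite ffunE (negPf jj).
move=> i; have [Hxi Hxa] := Hx i; have [Hyi Hya] := Hy i; split.
  move=> j'; rewrite ffunE PoszD; case: ifP => _.
    by move: Hyi; lia.
  by move: (Hxi j'); lia.
pose u : box := [ffun j' => inord (absz (x i j'))].
have uE : emb u = x i.
  apply/ffunP => j'; rewrite !ffunE; have := Hxi j'; case: (x i j') => // n.
  by rewrite ltz_nat lez_nat => /andP[_ nN] /=; rewrite inordK.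
rewrite -Hxa; have [_ Hy0] := Hy i0.
by move/ffunP: (etrans Hya (esym Hy0)) => /(_ u); rewrite !ffunE uE.
Qed.

(** * Linearly independent solutions *)

Lemma integer_kernel_basis (l k : nat) (A : 'M[int]_(l, k)) :
  \rank (ratmx A) = l ->
  exists2 W : 'M[int]_(k - l, k), row_free (ratmx W) &
    forall i, A *m (row i W)^T = 0.
Proof.
move=> rkA.
have [B Bfree BA] : exists2 B : 'M[rat]_(k - l, k), row_free B &
    B *m (ratmx A)^T = 0.
  have <- : \rank (kermx (ratmx A)^T) = (k - l)%N.
    by rewrite mxrank_ker mxrank_tr rkA.
  exists (row_base (kermx (ratmx A)^T)); first exact: row_base_free.
  by apply/sub_kermxP; rewrite eq_row_base.
have [c c0 [g Hg]] := common_denominator (fun z : 'I_(k - l) * 'I_k => B z.1 z.2).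
pose W := \matrix_(i, q) g (i, q).
have WE : ratmx W = c%:R *: B by apply/matrixP => i q; rewrite !mxE Hg.
exists W.
  rewrite /row_free WE mxrank_scale_nz; first exact: Bfree.
  by rewrite pnatr_eq0 -lt0n.
move=> i; suff : W *m A^T = 0.
  by move=> WA; rewrite -[LHS]trmxK trmx_mul trmxK -row_mul WA row0 trmx0.
have : ratmx W *m (ratmx A)^T = 0 by rewrite WE -scalemxAl BA scaler0.
rewrite /ratmx matrix.map_trmx -map_mxM => /matrixP h; apply/matrixP => a b.
by have := h a b; rewrite !mxE => /eqP; rewrite intr_eq0 => /eqP.
Qed.

(** Starting from the identity, the rows are replaced one by one by those of the perturbed matrix.
    At row [j] the determinants of the two choices differ by [e j] times the previous determinant,
    which is nonzero, so they cannot both vanish. *)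
Lemma det_diag_perturbation (F : fieldType) (D : nat) (Y : 'M[F]_D)
    (e : 'I_D -> F) :
  (forall i, e i != 0) ->
  exists b : 'I_D -> bool,
    \det (Y + diag_mx (\row_i if b i then e i else 0)) != 0.
Proof.
move=> e0.
pose Z (b : 'I_D -> bool) : 'M[F]_D := Y + diag_mx (\row_i if b i then e i else 0).
suff H n : (n <= D)%N -> exists b : 'I_D -> bool,
    \det (\matrix_i (if (i < n)%N then row i (Z b) else row i 1%:M)) != 0.
  have [b hb] := H D (leqnn D); exists b; apply: contraNneq hb => Z0.
  rewrite (_ : \matrix_i _ = Z b) ?Z0 //.
  by apply/row_matrixP => i; rewrite rowK ltn_ord.
elim: n => [|n IH] nD.
  exists (fun=> false); rewrite (_ : \matrix_i _ = 1%:M) ?det1 ?oner_neq0 //.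
  by apply/row_matrixP => i; rewrite rowK.
have [b hb] := IH (ltnW nD); pose j := Ordinal nD.
pose b' v i := if i == j then v else b i.
pose M v := \matrix_i (if (i < n.+1)%N then row i (Z (b' v)) else row i 1%:M).
suff [h|h] : \det (M true) != 0 \/ \det (M false) != 0.
- by exists (b' true).
- by exists (b' false).
have M0 v (i : 'I_D) : i != j -> row i (M v) =
    (if (i < n)%N then row i (Z b) else row i 1%:M).
  move=> ij; rewrite rowK ltnS leq_eqVlt.
  have /negPf -> /= : (i : nat) != n by apply: contraNneq ij => E; apply/eqP/val_inj.
  case: ifP => // _; apply/rowP => q; rewrite !mxE /b' (negPf ij).
  by have [] := eqVneq i q.
have off (P Q : 'M[F]_D) : (forall i, i != j -> row i P = row i Q) ->
    row' j P = row' j Q.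
  move=> h; apply/row_matrixP => i; have := h (lift j i).
  rewrite eq_sym neq_lift => /(_ isT) /rowP h'; apply/rowP => q.
  by have := h' q; rewrite !mxE.
set M1 := (\matrix_i _) in hb.
have detE : \det (M true) = 1 * \det (M false) + e j * \det M1.
  apply: (determinant_multilinear (i0 := j)).
  - rewrite !rowK /= ltnSn ltnn; apply/rowP => q; rewrite !mxE /b' eqxx.
    by rewrite mul0rn addr0 mul1r mulr_natr.
  - by apply: off => i ij; rewrite !M0.
  - by apply: off => i ij; rewrite M0 // rowK.
have [h|] := eqVneq (\det (M false)) 0; last by right.
by left; rewrite detE h mulr0 add0r mulf_neq0.
Qed.

(** The product configuration is indexed by [q] and a choice in [{ffun J -> bool}], and all its
    points share one colour. Hence the choice may be made after the colouring, so as to reach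
    independence. *)
Lemma independent_solutions_regular (d k : nat) (hk : (0 < k)%N)
    (l : 'I_d -> nat) (A : forall j : 'I_d, 'M[int]_(l j, k))
    (hrank : forall j : 'I_d, \rank (ratmx (A j)) = l j)
    (hcols : forall j : 'I_d, columns_condition (ratmx (A j)))
    (J := {j : 'I_d & 'I_(k - l j)})
    (pt := fun (j : 'I_d) (i : 'I_(k - l j)) =>
       Tagged (fun j => 'I_(k - l j)) i : J) (K : finType) :
  exists N : nat, forall chi : {ffun J -> int} -> K,
    exists (V : 'I_k -> {ffun J -> int}) (a : K),
      [/\ forall q, chi (V q) = a, forall q z, 0 < V q z <= N%:Z,
          forall z : J, A (tag z) *m (\col_q V q z) = 0
        & forall j (t : 'I_(k - l j) -> int),
            (forall q, \sum_i t i * V q (pt j i) = 0) -> forall i, t i = 0].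
Proof.
have exW j := cid2 (integer_kernel_basis (hrank j)).
pose W j := s2val (exW j).
have Wfree j : row_free (ratmx (W j)) := s2valP (exW j).
have AW j i : A j *m (row i (W j))^T = 0 := s2valP' (exW j) i.
pose w (z : J) : 'cV[int]_k := (row (tagged z) (W (tag z)))^T.
(* Coordinate [z] sees only its own bit of the choice. *)
pose h (z : J) (i : 'I_k * {ffun J -> bool}) := (i.1, i.2 z).
have reg z := partition_regular_comp (h z)
  (kernel_pair_regular (hcols (tag z)) (AW (tag z) (tagged z))).
have [N HN] := partition_regular_product (Ordinal hk, [ffun=> false]) reg K.
exists N => chi; have [x [a [Cx Hx]]] := HN chi.
have /choice[Xe HXe] : forall z : J, exists Xe : 'cV[int]_k * int,
    [/\ A (tag z) *m Xe.1 = 0, Xe.2 != 0 & forall q (b : {ffun J -> bool}),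
      x (q, b) z = Xe.1 q 0 + (if b z then Xe.2 * w z q 0 else 0)].
  move=> z; have [x0 [X [e [AX e0 xE]]] Ex] := Cx z.
  exists (X, e); split => // q b.
  by rewrite -xE -[RHS]/((x0 \o h z) (q, b)) -Ex.
(* [pinvmx] is a right inverse of the kernel basis and turns the added multiples of its rows into a
   diagonal matrix. [Q j b] is thus the matrix of solution rows times [pinvmx], and its
   invertibility forces these rows to be independent. *)
pose Q j (b : 'I_(k - l j) -> bool) : 'M[rat]_(k - l j) :=
  (\matrix_(i, q) ((Xe (pt j i)).1 q 0)%:~R) *m pinvmx (ratmx (W j)) +
  diag_mx (\row_i if b i then ((Xe (pt j i)).2)%:~R else 0).
have hb j : exists b, \det (Q j b) != 0.
  apply: det_diag_perturbation => i; rewrite intr_eq0.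
  by have [] := HXe (pt j i).
have {hb} [b Hb] : exists b : forall j, 'I_(k - l j) -> bool,
    forall j, \det (Q j (b j)) != 0.
  by exists (fun j => sval (cid (hb j))) => j; exact: (svalP (cid (hb j))).
pose L : {ffun J -> bool} := [ffun z => b (tag z) (tagged z)].
exists (fun q => x (q, L)), a; split.
- by move=> q; have [] := Hx (q, L).
- by move=> q z; have [] := Hx (q, L).
- move=> z; have [AX _ xE] := HXe z.
  have -> : \col_q x (q, L) z =
      (Xe z).1 + (if L z then (Xe z).2 else 0) *: w z.
    apply/colP => q; rewrite !mxE xE !mxE.
    by case: (L z); rewrite ?mul0r.
  by rewrite mulmxDr -scalemxAr AX AW scaler0 addr0.
- move=> j t Ht i.
  pose T : 'rV[rat]_(k - l j) := \row_i (t i)%:~R.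
  suff : T = 0.
    by move=> /rowP/(_ i); rewrite !mxE => /eqP; rewrite intr_eq0 => /eqP.
  have Qu : Q j (b j) \in unitmx by rewrite unitmxE unitfE.
  rewrite -[T](mulmxK Qu).
  suff -> : T *m Q j (b j) = 0 by rewrite mul0mx.
  pose B : 'M[rat]_(k - l j, k) := \matrix_(i, q) (x (q, L) (pt j i))%:~R.
  have TB : T *m B = 0.
    apply/rowP => q; rewrite !mxE.
    under eq_bigr do rewrite !mxE -intrM.
    by rewrite -(rmorph_sum intr) Ht.
  suff -> : Q j (b j) = B *m pinvmx (ratmx (W j)) by rewrite mulmxA TB mul0mx.
  rewrite /Q -[X in _ + X]mulmx1 -(mulmxVp (Wfree j)) [X in _ + X]mulmxA -mulmxDl.
  congr (_ *m _); apply/matrixP => i' q; rewrite mxE mul_diag_mx !mxE.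
  have [_ _ ->] := HXe (pt j i'); rewrite ffunE /= !mxE.
  by case: (b j i'); rewrite ?mul0r ?addr0 // rmorphD rmorphM.
Qed.

(** * Counting the solutions *)

(** The kernel contains a vector with a nonzero entry. It follows that each coordinate of the grid
    has at least one formal coordinate, which makes the images of formal points positive. *)
Lemma columns_condition_rank (l k : nat) (A : 'M[int]_(l, k)) :
  (0 < k)%N -> columns_condition (ratmx A) -> (\rank (ratmx A) < k)%N.
Proof.
move=> k0 /columns_condition_kernel [m [b [c [U [c0 _ Ub _ AU]]]]].
rewrite ltn_neqAle rank_leq_col andbT; apply/negP => full.
pose q := Ordinal k0; pose u := (map_mx intr (U (b q)) : 'cV[rat]_k)^T.
have : u *m (ratmx A)^T = 0 by rewrite -trmx_mul -map_mxM AU map_mx0 trmx0.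
move/eqP; rewrite mulmx_free_eq0; last by rewrite /row_free mxrank_tr.
move=> /eqP/rowP/(_ q); rewrite !mxE Ub => /eqP.
by rewrite intr_eq0 eqz_nat; case: c c0 {Ub}.
Qed.

Lemma card_mono_solutions_ge (d r k : nat) (hk : (0 < k)%N)
    (l : 'I_d -> nat) (A : forall j : 'I_d, 'M[int]_(l j, k))
    (hrank : forall j : 'I_d, \rank (ratmx (A j)) = l j)
    (hcols : forall j : 'I_d, columns_condition (ratmx (A j))) :
  exists C N0 : nat, forall n (chi : grid n d -> 'I_r), (N0 <= n)%N ->
    (n ^ (\sum_(j < d) (k - l j)) <= C * #|mono_solutions A chi|)%N.
Proof.
pose J : finType := {j : 'I_d & 'I_(k - l j)}.
pose pt (j : 'I_d) (i : 'I_(k - l j)) : J := Tagged (fun j => 'I_(k - l j)) i.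
have [N HN] := independent_solutions_regular hk hrank hcols 'I_r.
(* With [s = n %/ B], a sum of at most [k] products of a factor up to [s] and one up to [N] stays
   below [n]. The factor [2 * B] in the constant comes from [n <= 2 * B * s], valid for [n >= B]. *)
pose B := (N.+1 * k)%N.
pose pattern : finType := {ffun 'I_k -> {ffun J -> 'I_N.+1}}.
have B0 : (0 < B)%N by rewrite muln_gt0.
exists ((2 * B) ^ (\sum_(j < d) (k - l j)) * #|pattern|)%N, B.
case=> [|n] chi Bn; first by move: B0; rewrite ltnNge Bn.
pose s := (n.+1 %/ B)%N.
have s0 : (0 < s)%N by rewrite divn_gt0.
pose T : finType := {ffun J -> 'I_s}.
pose eval (t : T) (v : {ffun J -> int}) (j : 'I_d) : int :=
  \sum_(i < k - l j) (t (pt j i)).+1%:Z * v (pt j i).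
have evalP (t : T) (v : {ffun J -> int}) j :
    (forall z, 0 < v z <= N%:Z) -> 0 < eval t v j <= n.+1%:Z.
  move=> hv; apply/andP; split.
    have kl : (0 < k - l j)%N.
      by rewrite subn_gt0 -(hrank j) columns_condition_rank.
    rewrite /eval (bigD1 (Ordinal kl)) //= ltr_wpDr //.
      apply: sumr_ge0 => i _; rewrite mulr_ge0 // ltW //.
      by case/andP: (hv (pt j i)).
    by rewrite mulr_gt0 //; case/andP: (hv (pt j (Ordinal kl))).
  apply: (@le_trans _ _ (\sum_(i < k - l j) (s * N.+1)%N%:Z)).
    apply: ler_sum => i _; rewrite PoszM ler_pM //.
    - by apply: ltW; case/andP: (hv (pt j i)).
    - by rewrite lez_nat ltn_ord.
    - by case/andP: (hv (pt j i)) => _ h; rewrite (le_trans h) // lez_nat.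
  rewrite sumr_const card_ord -mulr_natr -[X in _ * X]/((k - l j)%N%:R).
  rewrite natz -PoszM lez_nat (leq_trans _ (leq_trunc_div n.+1 B)) //.
  by rewrite -mulnA leq_mul2l leq_mul2l leq_subr !orbT.
pose point (f : 'I_d -> int) : grid n.+1 d := [ffun j => inord (absz (f j)).-1].
have pointE f : (forall j, 0 < f j <= n.+1%:Z) ->
    forall j, (point f j).+1%:Z = f j.
  move=> hf j; rewrite ffunE; have := hf j; case: (f j) => // x.
  by rewrite ltz_nat lez_nat => /andP[x0 xn] /=; rewrite inordK prednK.
have exF (t : T) : exists F : pattern * k.-tuple (grid n.+1 d),
    [/\ F.2 \in mono_solutions A chi,
      forall q j, (tnth F.2 q j).+1%:Z =
        \sum_(i < k - l j) (t (pt j i)).+1%:Z * (F.1 q (pt j i) : nat)%:Z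
    & forall j (u : 'I_(k - l j) -> int),
        (forall q, \sum_i u i * (F.1 q (pt j i) : nat)%:Z = 0) ->
        forall i, u i = 0].
  have [V [a [Va Vb AV Vi]]] := HN (fun v => chi (point (eval t v))).
  pose P : pattern := [ffun q => [ffun z => inord (absz (V q z))]].
  have PE q z : (P q z : nat)%:Z = V q z.
    rewrite !ffunE; have := Vb q z; case: (V q z) => // x.
    by rewrite ltz_nat lez_nat => /andP[_ xN] /=; rewrite inordK.
  exists (P, [tuple point (eval t (V q)) | q < k]); split => /=.
  - rewrite inE; apply/andP; split.
      by apply/existsP; exists a; apply/forallP => q; rewrite tnth_mktuple Va.
    apply/forallP => j; apply/eqP.
    have -> : (row j (point_mx [tuple point (eval t (V q)) | q < k]))^T =
        \sum_(i < k - l j) (t (pt j i)).+1%:Z *: \col_q V q (pt j i).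
      apply/colP => q; rewrite !mxE tnth_mktuple pointE //; last first.
        by move=> j'; apply: evalP.
      by rewrite summxE; apply: eq_bigr => i _; rewrite !mxE.
    rewrite mulmx_sumr big1 // => i _.
    by rewrite -scalemxAr (AV (pt j i)) scaler0.
  - move=> q j; rewrite tnth_mktuple pointE; last by move=> j'; apply: evalP.
    by apply: eq_bigr => i _; rewrite PE.
  - move=> j u hu; apply: Vi => q; rewrite -[RHS](hu q).
    by apply: eq_bigr => i _; rewrite PE.
have [F HF] := choice exF.
(* If [t] and [t'] share pattern and solution, then [t - t'] annihilates all points of the pattern,
   hence is 0 by independence. *)
have Finj : injective F.
  move=> t t' E; have [_ h1 h2] := HF t; have [_ h1' _] := HF t'.
  apply/ffunP => -[j i]; apply/val_inj/eqP; rewrite -eqSS -eqz_nat -subr_eq0.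
  apply/eqP/(h2 j (fun i => (t (pt j i)).+1%:Z - (t' (pt j i)).+1%:Z)) => q.
  under eq_bigr do rewrite mulrBl.
  by rewrite sumrB -h1 E -h1' subrr.
have cardJ : #|J| = (\sum_(j < d) (k - l j))%N.
  rewrite card_tagged sumnE big_map big_enum.
  by apply: eq_bigr => j _; rewrite card_ord.
have cardT : (s ^ #|J| <= #|pattern| * #|mono_solutions A chi|)%N.
  have : [set F t | t in [set: T]] \subset
      finset.setX [set: pattern] (mono_solutions A chi).
    apply/fintype.subsetP => _ /imsetP[t _ ->].
    rewrite [F t]surjective_pairing finset.in_setX finset.in_setT.
    by have [] := HF t.
  move/subset_leq_card; rewrite card_imset // cardsX !cardsT.
  by rewrite [X in (X <= _)%N]card_ffun card_ord.
rewrite -cardJ -mulnA (leq_trans _ (leq_mul (leqnn _) cardT)) // -expnMn.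
case: #|J| => // e; rewrite leq_exp2r // (leq_trans (ltnW (ltn_ceil _ B0))) //.
by rewrite -/s mulnAC leq_mul2r mul2n -addnn -addn1 leq_add2l s0 orbT.
Qed.

Local Open Scope classical_set_scope.
Local Open Scope ring_scope.

Theorem theorem19 (R : realType) (d r k : nat)
    (hd : (0 < d)%N) (hr : (0 < r)%N) (hk : (0 < k)%N)
    (l : 'I_d -> nat) (A : forall j : 'I_d, 'M[int]_(l j, k))
    (hrank : forall j : 'I_d, \rank (ratmx (A j)) = l j)
    (hcols : forall j : 'I_d, columns_condition (ratmx (A j))) :
  exists2 c : R, 0 < c &
    exists2 eps : nat -> R, eps n @[n --> \oo] --> (0 : R) &
      forall (n : nat) (chi : grid n d -> 'I_r),
        c * n%:R ^+ (\sum_(j < d) (k - l j))%N * (1 + eps n)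
          <= #|mono_solutions A chi|%:R.
Proof.
have [C [N0 HC]] := card_mono_solutions_ge r hk hrank hcols.
exists C.+1%:R^-1; first by rewrite invr_gt0 ltr0n.
(* Below [N0] the value -1 turns the lower bound into 0. *)
exists (fun n => if (N0 <= n)%N then 0 else -1).
  apply: (@cvg_near_cst _ _ _ _ \oo); exists N0 => // n /=.
  by move=> ->.
move=> n chi; case: leqP => hn; last by rewrite addrN mulr0 ler0n.
rewrite addr0 mulr1 ler_pdivrMl ?ltr0n // -natrX -natrM ler_nat.
by rewrite (leq_trans (HC n chi hn)) // leq_mul2r leqnSn orbT.
Qed.
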